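(* Fix $p\in[1,2]$ and let $(X,\|\cdot\|_X)$ be a normed space of Rademacher type $p$. Then for every $n\in\mathbb N$, $\boldsymbol\alpha=(\alpha_1,\dots,\alpha_n)\in(0,1)^n$ and $f:\{-1,1\}^n\to X$, $$\int_{\{-1,1\}^n}\Big\|f(x)-\int f\,d\mu_{\boldsymbol\alpha}\Big\|_X^p\,d\mu_{\boldsymbol\alpha}(x)\le\big(2\pi\,\mathsf T_p(X)\big)^p\sum_{i=1}^n\int_{\{-1,1\}^n}\big\|\partial_i^{\alpha_i}f(x)\big\|_X^p\,d\mu_{\boldsymbol\alpha}(x).$$
   Context: $\mu_\alpha$ is the measure on $\{-1,1\}$ with $\mu_\alpha\{1\}=\alpha$, $\mu_\alpha\{-1\}=1-\alpha$, and $\mu_{\boldsymbol\alpha}=\mu_{\alpha_1}\otimes\cdots\otimes\mu_{\alpha_n}$. $\partial_i^\beta f(x)=f(x)-\beta f(x_1,\dots,x_{i-1},1,x_{i+1},\dots,x_n)-(1-\beta)f(x_1,\dots,x_{i-1},-1,x_{i+1},\dots,x_n)$. $\sigma_n$ is the uniform probability on $\{-1,1\}^n$; $\mathsf T_p(X)$ is the least $T$ such that $\int\|\sum_{i=1}^nx_iv_i\|_X^p\,d\sigma_n(x)\le T^p\sum_i\|v_i\|_X^p$ for all $n$ and $v_1,\dots,v_n\in X$; $X$ has Rademacher type $p$ if $\mathsf T_p(X)<\infty$. *)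

(* Defs.v *)
From HB Require Import structures.
From mathcomp Require Import all_boot all_order all_algebra.
From mathcomp Require Import all_classical all_reals all_analysis.
Set Implicit Arguments. Unset Strict Implicit. Unset Printing Implicit Defensive.
Import Order.TTheory GRing.Theory Num.Theory.
Local Open Scope ring_scope.
Local Open Scope classical_set_scope.

Section Defs.
Variables (R : realType) (X : normedModType R).

(* The discrete cube {-1,1}^n: a point x is encoded by a boolean function,
   with true <-> coordinate +1 and false <-> coordinate -1. *)
Definition cube (n : nat) := {ffun 'I_n -> bool}.

Definition sgnb (b : bool) : R := if b then 1 else -1.

Definition mu_alpha n (alpha : 'I_n -> R) (x : cube n) : R :=
  \prod_(i < n) (if x i then alpha i else 1 - alpha i).

Definition int_mu n (alpha : 'I_n -> R) (g : cube n -> R) : R :=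
  \sum_(x : cube n) mu_alpha alpha x * g x.

Definition int_mu_vec n (alpha : 'I_n -> R) (f : cube n -> X) : X :=
  \sum_(x : cube n) mu_alpha alpha x *: f x.

Definition setcoord n (x : cube n) (i : 'I_n) (b : bool) : cube n :=
  [ffun j => if j == i then b else x j].

Definition partial n (beta : R) (i : 'I_n) (f : cube n -> X) (x : cube n) : X :=
  f x - beta *: f (setcoord x i true) - (1 - beta) *: f (setcoord x i false).

Definition int_sigma n (g : cube n -> R) : R :=
  (2 ^+ n)^-1 * \sum_(x : cube n) g x.

Definition type_constants (p : R) : set R :=
  [set T : R | 0 <= T /\
     forall (n : nat) (v : 'I_n -> X),
       int_sigma (fun x : cube n => `| \sum_(i < n) sgnb (x i) *: v i | `^ p)
       <= T `^ p * \sum_(i < n) `| v i | `^ p].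

Definition type_const (p : R) : R := inf (type_constants p).

Definition has_rademacher_type (p : R) : Prop := exists T, type_constants p T.

End Defs.

(* Main.v *)
(** The proof interpolates between [f] and its mean by the noise semigroup
    [P_s f x], the average of [f] when each coordinate of [x] is kept with probability
    [s] and resampled from [mu_alpha] otherwise, so that [P_1 f = f] and [P_0 f] is
    the mean. The derivative of [P_s f x] in [s] is the average, over the noisy copy
    [y] of [x], of [\sum_i h_i(x_i, y_i) partial_i f y], where given [y] the weights
    [h_i] are independent and centred. By Jensen and reversibility, its L^p norm is at
    most that of [\sum_i h_i v_i] for fixed vectors [v_i = partial_i f y]; symmetrization
    and Rademacher type [p] bound this by [2 T / sqrt (s (1 - s))] times the L^p norm of
    the gradient. Since [\int_0^1 ds / sqrt (s (1 - s)) = pi], integration over [s] gives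
    the constant [2 pi T]. The integral is replaced by a telescoping sum with equal
    steps in the angle [t], where [s = (1 - cos t) / 2]. *)
Require Import Defs.
From HB Require Import structures.
From mathcomp Require Import all_boot all_order all_algebra.
From mathcomp Require Import all_classical all_reals all_analysis.
From mathcomp Require Import ring lra.
Import Order.TTheory GRing.Theory Num.Theory.
Import numFieldNormedType.Exports.
Local Open Scope ring_scope.
Set Implicit Arguments.
Unset Strict Implicit.
Unset Printing Implicit Defensive.

(** * Jensen and Minkowski inequalities for finite weights *)

(** Young's inequality for [m ^ (p - 1)] and [t i], with [m] the mean, is averaged over [i], and
    [m ^ p / q] is moved to the left. The case [p = 1] stands apart, having no finite conjugate
    exponent. *)
Lemma powR_jensen (R : realType) (I : finType) (p : R) (w t : I -> R) :
  1 <= p -> (forall i, 0 <= w i) -> \sum_i w i = 1 -> (forall i, 0 <= t i) ->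
  (\sum_i w i * t i) `^ p <= \sum_i w i * t i `^ p.
Proof.
move=> p1 w0 w1 t0; set m := \sum_i w i * t i.
have m0 : 0 <= m by apply: sumr_ge0 => i _; rewrite mulr_ge0.
move: (p1); rewrite le_eqVlt => /predU1P[<-|p_gt1].
  by rewrite powRr1//; apply: ler_sum => i _; rewrite powRr1.
have p0 : 0 < p by lra.
pose q := p / (p - 1).
have q0 : 0 < q by rewrite divr_gt0//; lra.
have pq : p^-1 + q^-1 = 1.
  by rewrite /q invf_div -{1}(div1r p) -mulrDl subrKC mulfV// gt_eqF.
have young : \sum_i w i * (m `^ (p - 1) * t i) <=
             \sum_i w i * (m `^ p / q + t i `^ p / p).
  apply: ler_sum => i _; apply: ler_wpM2l => //.
  rewrite (_ : m `^ p = (m `^ (p - 1)) `^ q).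
    by apply: conjugate_powR; rewrite ?powR_ge0// addrC.
  by rewrite -powRrM /q mulrC divfK// subr_eq0 gt_eqF.
have lhsE : \sum_i w i * (m `^ (p - 1) * t i) = m `^ p.
  rewrite -(mulr_powRB1 m0 p0) {1}/m mulr_suml.
  by apply: eq_bigr => i _; ring.
have rhsE : \sum_i w i * (m `^ p / q + t i `^ p / p) =
            m `^ p / q + (\sum_i w i * t i `^ p) / p.
  rewrite -[m `^ p / q in RHS]mul1r -w1 !mulr_suml -big_split/=.
  by apply: eq_bigr => i _; ring.
move: young; rewrite lhsE rhsE -lerBlDl -[X in X - _]mulr1 -mulrBr.
by rewrite (_ : 1 - q^-1 = p^-1) ?ler_pM2r ?invr_gt0// -pq addrK.
Qed.

Lemma normr_jensen (R : realType) (X : normedModType R) (I : finType) (p : R)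
    (w : I -> R) (u : I -> X) :
  1 <= p -> (forall i, 0 <= w i) -> \sum_i w i = 1 ->
  `| \sum_i w i *: u i | `^ p <= \sum_i w i * `| u i | `^ p.
Proof.
move=> p1 w0 w1; apply: le_trans (powR_jensen p1 w0 w1 (fun i => normr_ge0 _)).
apply: ge0_ler_powR; rewrite ?nnegrE//; first by lra.
  by apply: sumr_ge0 => i _; rewrite mulr_ge0.
apply: le_trans (ler_norm_sum _ _ _) _; apply: ler_sum => i _.
by rewrite normrZ ger0_norm.
Qed.

(* Minkowski's inequality for the weighted l^p norm, stated with upper bounds
   [A] and [B] for the two norms so that no p-th root is needed. *)
Lemma minkowski_le (R : realType) (X : normedModType R) (I : finType) (p : R)
    (w : I -> R) (u v : I -> X) (A B : R) :
  1 <= p -> (forall i, 0 <= w i) -> 0 < A -> 0 < B ->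
  \sum_i w i * `| u i | `^ p <= A `^ p ->
  \sum_i w i * `| v i | `^ p <= B `^ p ->
  \sum_i w i * `| u i + v i | `^ p <= (A + B) `^ p.
Proof.
move=> p1 w0 A0 B0 hu hv.
have AB0 : 0 < A + B by rewrite addr_gt0.
(* [u i + v i] is [A + B] times a convex combination of [u i / A] and [v i / B], to which Jensen
   applies. *)
pose c b := (if b then A else B) / (A + B).
pose z i b := if b then A^-1 *: u i else B^-1 *: v i.
have step i : `| u i + v i | `^ p <=
    (A + B) `^ p * (A / (A + B) * (`| u i | `^ p / A `^ p) +
                    B / (A + B) * (`| v i | `^ p / B `^ p)).
  have -> : u i + v i = (A + B) *: \sum_b c b *: z i b.
    have cancelAB a : 0 < a -> (A + B) * (a / (A + B)) * a^-1 = 1.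
      by move=> a0; rewrite mulrCA mulfV ?gt_eqF// mulr1 mulfV// gt_eqF.
    by rewrite big_bool /c /z /= scalerDr !scalerA !cancelAB// !scale1r.
  rewrite normrZ (ger0_norm (ltW AB0)) powRM ?(ltW AB0)//.
  apply: ler_wpM2l; first exact: powR_ge0.
  apply: (le_trans (@normr_jensen _ _ bool p c (z i) p1 _ _)).
  - by case; rewrite /c divr_ge0 ?ltW.
  - by rewrite big_bool /c /= -mulrDl divff// gt_eqF.
  have powV (a x : R) : 0 < a -> 0 <= x -> (a^-1 * x) `^ p = x `^ p / a `^ p.
    move=> a0 x0; rewrite powRM ?invr_ge0 ?(ltW a0)// mulrC; congr (_ * _).
    by rewrite -(powR_inv1 (ltW a0)) -powRrM mulN1r powRN.
  rewrite big_bool /c /z /= !normrZ !gtr0_norm ?invr_gt0//.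
  by rewrite !powV.
apply: (@le_trans _ _ ((A + B) `^ p *
    (A / (A + B) * ((\sum_i w i * `| u i | `^ p) / A `^ p) +
     B / (A + B) * ((\sum_i w i * `| v i | `^ p) / B `^ p)))).
  rewrite !mulr_suml !mulr_sumr -big_split/= mulr_sumr.
  apply: ler_sum => i _; apply: (le_trans (ler_wpM2l (w0 i) (step i))).
  by rewrite le_eqVlt; apply/orP; left; apply/eqP; ring.
rewrite -[leRHS]mulr1; apply: ler_wpM2l; first exact: powR_ge0.
apply: (@le_trans _ _ (A / (A + B) * 1 + B / (A + B) * 1)); last first.
  by rewrite !mulr1 -mulrDl divff// gt_eqF.
by apply: lerD; apply: ler_wpM2l; rewrite ?divr_ge0 ?(ltW AB0) ?(ltW A0) ?(ltW B0)//
  ler_pdivrMr ?powR_gt0// mul1r.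
Qed.

Lemma minkowski_sum_le (R : realType) (X : normedModType R) (I : finType)
    (p : R) (w : I -> R) (u : nat -> I -> X) (A : R) (m : nat) :
  1 <= p -> (forall i, 0 <= w i) -> 0 < A ->
  (forall k, (k <= m)%N -> \sum_i w i * `| u k i | `^ p <= A `^ p) ->
  \sum_i w i * `| \sum_(k < m.+1) u k i | `^ p <= (m.+1%:R * A) `^ p.
Proof.
move=> p1 w0 A0; elim: m => [|m IH] hu.
  rewrite mul1r; under eq_bigr do rewrite big_ord1; exact: hu.
rewrite -[m.+2%:R]natr1 mulrDl mul1r.
under eq_bigr do rewrite big_ord_recr/=.
apply: minkowski_le; rewrite ?mulr_gt0//; last exact: hu.
by apply: IH => k km; apply: hu; exact: leqW.
Qed.

Lemma norm_sum_bound_powR (R : realType) (X : normedModType R) (I : finType)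
    (p : R) (w : I -> R) (u : I -> X) (A : R) :
  0 <= p -> (forall i, 0 <= w i) -> \sum_i w i = 1 ->
  (forall i, `| u i | <= A) -> \sum_i w i * `| u i | `^ p <= A `^ p.
Proof.
move=> p0 w0 w1 uA; rewrite -[leRHS]mul1r -w1 mulr_suml.
apply: ler_sum => i _; apply: ler_wpM2l => //; apply: ge0_ler_powR; rewrite ?nnegrE//.
exact: le_trans (normr_ge0 _) (uA i).
Qed.

(** * Estimates for the cosine and a moment bound *)

(** The mean value theorem is used twice: for [cos] on [[a, b]], then for [sin] between [a] and the
    intermediate point. *)
Lemma cos_taylor1 (R : realType) (a b : R) :
  a <= b -> `| cos b - cos a + (b - a) * sin a | <= (b - a) ^+ 2.
Proof.
move=> ab.
have [c cab ->] := @MVT_segment R cos (fun x => - sin x) a b ab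
  (fun x _ => is_derive_cos x) (continuous_subspaceT (@continuous_cos R)).
move: cab; rewrite in_itv/= => /andP[ac cb].
have [d _ hd] := @MVT_segment R sin cos a c ac
  (fun x _ => is_derive_sin x) (continuous_subspaceT (@continuous_sin R)).
rewrite (_ : _ + _ = - (b - a) * (sin c - sin a)); last by ring.
have ba0 : 0 <= b - a by rewrite subr_ge0.
have ca0 : 0 <= c - a by rewrite subr_ge0.
rewrite hd !normrM normrN (ger0_norm ba0) (ger0_norm ca0) expr2.
apply: ler_wpM2l => //; rewrite -[leRHS]mul1r.
by apply: ler_pM; rewrite ?cos_max// lerB.
Qed.

Lemma cos_lipschitz (R : realType) (a b : R) :
  a <= b -> `| cos b - cos a | <= b - a.
Proof.
move=> ab.
have [c _ ->] := @MVT_segment R cos (fun x => - sin x) a b ab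
  (fun x _ => is_derive_cos x) (continuous_subspaceT (@continuous_cos R)).
rewrite normrM normrN (ger0_norm (_ : 0 <= b - a)) ?subr_ge0//.
by rewrite -[leRHS]mul1r ler_wpM2r ?subr_ge0// sin_max.
Qed.

(** With [z = |c| / (2 w)] the claim reads [2 w z ^ p <= 1]. For [z <= 1] this follows from
    [2 w <= 1]; for [z > 1], from [z ^ p <= z ^ 2] and the bound on [c ^ 2]. *)
Lemma two_point_moment (R : realType) (p w c : R) :
  0 <= p <= 2 -> 0 < w -> w <= 4^-1 -> c ^+ 2 <= 2 * w ->
  2 * w * (`| c | / w) `^ p <= 2 `^ p.
Proof.
move=> /andP[p0 p2] w0 w4 cw.
set z := `|c| / (2 * w).
have z0 : 0 <= z by rewrite divr_ge0// mulr_ge0// ltW.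
have -> : `|c| / w = 2 * z by rewrite /z; field; rewrite gt_eqF.
rewrite powRM// mulrCA -[leRHS]mulr1; apply: ler_wpM2l; first exact: powR_ge0.
have [z1|z1] := leP z 1.
  rewrite (@le_trans _ _ (2 * w * 1)) ?ler_pM2l ?mulr_gt0//; last by lra.
  apply: (@le_trans _ _ (1 `^ p)); last by rewrite powR1.
  by apply: ge0_ler_powR; rewrite ?nnegrE.
rewrite (@le_trans _ _ (2 * w * z `^ 2))//.
  by rewrite ler_pM2l ?mulr_gt0//; apply: ler_powR => //; exact: ltW.
rewrite (powR_mulrn 2)// /z expr_div_n real_normK ?num_real//.
rewrite (_ : _ * _ = c ^+ 2 / (2 * w)); last by field; rewrite gt_eqF.
by rewrite ler_pdivrMr ?mulr_gt0// mul1r.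
Qed.

(** * Product measures on the cube and symmetrization *)

Lemma sum_cube_prod (R : realType) (n : nat) (F : 'I_n -> bool -> R) :
  \sum_(x : cube n) \prod_i F i (x i) = \prod_i (F i true + F i false).
Proof.
rewrite -(bigA_distr_bigA (fun i b => F i b)).
by apply: eq_bigr => i _; rewrite big_bool.
Qed.

Lemma mu_alpha_ge0 (R : realType) (n : nat) (a : 'I_n -> R) (x : cube n) :
  (forall i, 0 <= a i <= 1) -> 0 <= mu_alpha a x.
Proof.
move=> a01; apply: prodr_ge0 => i _.
by have /andP[a0 a1] := a01 i; case: (x i); rewrite ?subr_ge0.
Qed.

Lemma sum_mu_alpha (R : realType) (n : nat) (a : 'I_n -> R) :
  \sum_(x : cube n) mu_alpha a x = 1.
Proof.
rewrite (sum_cube_prod (fun i b => if b then a i else 1 - a i)).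
by rewrite big1// => i _; rewrite subrKC.
Qed.

Lemma mu_alpha_marginal (R : realType) (n : nat) (a : 'I_n -> R) (i : 'I_n)
    (F : bool -> R) :
  \sum_(x : cube n) mu_alpha a x * F (x i) =
  a i * F true + (1 - a i) * F false.
Proof.
(* [F (x i)] is written as a product whose factors off [i] are 1, so that the sum over the cube
   factorizes. *)
pose G j b := (if b then a j else 1 - a j) * (if j == i then F b else 1).
transitivity (\sum_(x : cube n) \prod_j G j (x j)).
  apply: eq_bigr => x _; rewrite big_split/=; congr (_ * _).
  by rewrite -big_mkcond/= big_pred1_eq.
rewrite sum_cube_prod (bigD1 i)//= big1 ?mulr1 => [|j ji].
  by rewrite /G eqxx.
by rewrite /G (negbTE ji) !mulr1 subrKC.
Qed.

(* The standard symmetrization: replacing [H i (x i)] by its difference with an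
   independent copy makes the summands symmetric, so random signs can be inserted. *)
Lemma type_mean_zero_sum (R : realType) (X : normedModType R) (p T M : R)
    (n : nat) (a : 'I_n -> R) (H : 'I_n -> bool -> R) (v : 'I_n -> X) :
  1 <= p -> type_constants X p T -> (forall i, 0 <= a i <= 1) ->
  (forall i, a i * H i true + (1 - a i) * H i false = 0) ->
  (forall i, 2 * (a i * (1 - a i)) * `| H i true - H i false | `^ p <= M) ->
  \sum_(x : cube n) mu_alpha a x * `| \sum_i H i (x i) *: v i | `^ p
  <= M * (T `^ p * \sum_i `| v i | `^ p).
Proof.
move=> p1 [T0 hT] a01 H0 HM.
have pn0 : p != 0 by rewrite gt_eqF//; lra.
have mu0 x : 0 <= mu_alpha a x by exact: mu_alpha_ge0.
pose w i (x x' : cube n) := (H i (x i) - H i (x' i)) *: v i.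
pose Z := \sum_(x : cube n) \sum_(x' : cube n)
  mu_alpha a x * mu_alpha a x' * `| \sum_i w i x x' | `^ p.
(* Since the weights are centred, averaging over the copy [x'] recovers [H i (x i)]; Jensen in [x']
   then applies. *)
have leZ : \sum_(x : cube n) mu_alpha a x * `| \sum_i H i (x i) *: v i | `^ p <= Z.
  apply: ler_sum => x _; under [leRHS]eq_bigr do rewrite -mulrA.
  rewrite -mulr_sumr; apply: ler_wpM2l => //.
  apply: le_trans (normr_jensen _ p1 mu0 (sum_mu_alpha a)).
  rewrite le_eqVlt; apply/orP; left; apply/eqP; congr (`| _ | `^ _).
  under [RHS]eq_bigr do rewrite scaler_sumr.
  rewrite exchange_big/=; apply: eq_bigr => i _.
  under [RHS]eq_bigr do rewrite scalerA.
  rewrite -scaler_suml; congr (_ *: _).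
  rewrite (mu_alpha_marginal a i (fun b => H i (x i) - H i b)).
  by rewrite -[LHS]subr0 -(H0 i); ring.
(* Swapping [x i] and [x' i] wherever [e i] is false preserves the product measure and flips the
   sign of exactly those terms. *)
have signZ (e : cube n) : Z = \sum_(x : cube n) \sum_(x' : cube n)
    mu_alpha a x * mu_alpha a x' * `| \sum_i sgnb R (e i) *: w i x x' | `^ p.
  pose sel (x x' : cube n) : cube n := [ffun i => if e i then x i else x' i].
  pose swp (z : cube n * cube n) := (sel z.1 z.2, sel z.2 z.1).
  have swpK : involutive swp.
    move=> [x x']; rewrite /swp/=.
    by congr pair; apply/ffunP => i; rewrite !ffunE; case: (e i).
  rewrite /Z !pair_big/= (reindex_inj (inv_inj swpK))/=.
  apply: eq_bigr => -[x x'] _ /=.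
  congr (_ * _); last congr (`| _ | `^ _).
    rewrite /mu_alpha -!big_split/=; apply: eq_bigr => i _.
    by rewrite !ffunE; case: (e i) => //; rewrite mulrC.
  apply: eq_bigr => i _; rewrite /w !ffunE /sgnb.
  by case: (e i); rewrite ?scale1r// scaleN1r -scaleNr opprB.
apply: (le_trans leZ).
have avgZ : Z = \sum_(x : cube n) \sum_(x' : cube n) mu_alpha a x * mu_alpha a x' *
    int_sigma (fun e : cube n => `| \sum_i sgnb R (e i) *: w i x x' | `^ p).
  have card : (2 ^+ n : R) = #|{: cube n}|%:R.
    by rewrite card_ffun card_bool card_ord natrX.
  have -> : Z = (2 ^+ n)^-1 * \sum_(e : cube n) Z.
    by rewrite sumr_const -[Z *+ _]mulr_natl -card mulKf// expf_neq0.
  rewrite (eq_bigr _ (fun e _ => signZ e)) exchange_big mulr_sumr/=.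
  apply: eq_bigr => x _; rewrite exchange_big mulr_sumr/=.
  by apply: eq_bigr => x' _; rewrite -mulr_sumr mulrCA.
rewrite avgZ.
apply: (@le_trans _ _ (\sum_(x : cube n) \sum_(x' : cube n)
    mu_alpha a x * mu_alpha a x' * (T `^ p * \sum_i `| w i x x' | `^ p))).
  by do 2 (apply: ler_sum => ? _); apply: ler_wpM2l; rewrite ?mulr_ge0.
have -> : \sum_(x : cube n) \sum_(x' : cube n)
    mu_alpha a x * mu_alpha a x' * (T `^ p * \sum_i `| w i x x' | `^ p) =
    T `^ p * \sum_i \sum_(x : cube n) mu_alpha a x * (\sum_(x' : cube n) mu_alpha a x' *
      (`| H i (x i) - H i (x' i) | `^ p * `| v i | `^ p)).
  rewrite [in RHS]exchange_big [RHS]mulr_sumr/=; apply: eq_bigr => x _.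
  under [LHS]eq_bigr do rewrite -mulrA.
  rewrite -!mulr_sumr [in RHS]exchange_big [RHS]mulrCA/=; congr (_ * _).
  rewrite [RHS]mulr_sumr; apply: eq_bigr => x' _.
  rewrite -[in RHS]mulr_sumr [RHS]mulrCA; congr (_ * (_ * _)).
  by apply: eq_bigr => i _; rewrite /w normrZ powRM.
rewrite mulrCA; apply: ler_wpM2l; first exact: powR_ge0.
rewrite mulr_sumr; apply: ler_sum => i _.
(* The two copies differ at [i] with probability [2 * (a i * (1 - a i))]; equal values contribute
   0. *)
under eq_bigr => x _ do rewrite (mu_alpha_marginal a i
  (fun b => `| H i (x i) - H i b | `^ p * `| v i | `^ p)).
rewrite (mu_alpha_marginal a i (fun b => a i * (`| H i b - H i true | `^ p * `| v i | `^ p)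
  + (1 - a i) * (`| H i b - H i false | `^ p * `| v i | `^ p))).
rewrite !subrr normr0 powR0// (distrC (H i false)).
apply: le_trans (ler_wpM2r (powR_ge0 _ _) (HM i)).
by rewrite le_eqVlt; apply/orP; left; apply/eqP; ring.
Qed.

(** * Expansion of products and the noise kernel *)

(** Induction on the number of factors. [C] depends on [n] alone, which later makes the error
    uniform over the points of the cube and the noise parameters. *)
Lemma prod_expansion (R : realType) (n : nat) :
  exists2 C : R, 0 <= C & forall (m e : 'I_n -> R) (h : R),
    (forall i, `| m i | <= 1) -> (forall i, `| e i | <= 1) -> `| h | <= 1 ->
    `| \prod_i (m i + h * e i) - \prod_i m i -
       h * \sum_i \prod_j (if j == i then e j else m j) | <= C * h ^+ 2.
Proof.
elim: n => [|n [C C0 IH]].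
  by exists 0 => // m e h _ _ _; rewrite !big_ord0 mulr0 subrr subr0 normr0 mul0r.
exists (2 * C + n%:R); first by rewrite addr_ge0 ?mulr_ge0.
move=> m e h m1 e1 h1; rewrite !big_ord_recl/=.
under [\sum_(i < n) _]eq_bigr do rewrite big_ord_recl/=.
set Q := \prod_(i < n) (m (lift ord0 i) + _).
set Q0 := \prod_(i < n) m (lift ord0 i).
set Q1 := \sum_(i < n) \prod_(j < n)
  (if j == i then e (lift ord0 j) else m (lift ord0 j)).
have -> : \sum_(i < n) m ord0 * \prod_(j < n)
    (if lift ord0 j == lift ord0 i then e (lift ord0 j) else m (lift ord0 j)) =
    m ord0 * Q1.
  by rewrite /Q1 mulr_sumr; apply: eq_bigr => i _; congr (_ * _).
have {}IH : `| Q - Q0 - h * Q1 | <= C * h ^+ 2.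
  exact: (IH _ _ h (fun i => m1 (lift ord0 i)) (fun i => e1 (lift ord0 i)) h1).
have Q1n : `| Q1 | <= n%:R.
  apply: le_trans (ler_norm_sum _ _ _) _.
  have -> : n%:R = \sum_(i < n) (1 : R) by rewrite sumr_const card_ord.
  apply: ler_sum => i _; rewrite normr_prod.
  by apply: prodr_ile1 => j _; rewrite normr_ge0/=; case: ifP.
have h2 : `| h | ^+ 2 = h ^+ 2 by rewrite real_normK ?num_real.
(* [Q - Q0] is itself of order [h], so this cross term is of order [h ^ 2]. *)
have QQ0 : `| h * e ord0 * (Q - Q0) | <= (C + n%:R) * h ^+ 2.
  have -> : Q - Q0 = (Q - Q0 - h * Q1) + h * Q1 by ring.
  rewrite normrM normrM.
  apply: (@le_trans _ _ (`|h| * 1 * (`| Q - Q0 - h * Q1 | + `| h * Q1 |))).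
    by apply: ler_pM; rewrite ?mulr_ge0 ?ler_normD// ler_wpM2l.
  rewrite mulr1 mulrDr (mulrDl C); apply: lerD.
    by apply: le_trans IH; rewrite ler_piMl.
  by rewrite normrM mulrA -expr2 h2 mulrC ler_wpM2r ?sqr_ge0.
have -> : (m ord0 + h * e ord0) * Q - m ord0 * Q0 - h * (e ord0 * Q0 + m ord0 * Q1) =
    m ord0 * (Q - Q0 - h * Q1) + h * e ord0 * (Q - Q0) by ring.
apply: le_trans (ler_normD _ _) _.
rewrite (_ : 2 * C + n%:R = C + (C + n%:R)) ?mulrDl ?(mulrDl C (C + _)); last by ring.
apply: lerD; last by rewrite -mulrDl.
by rewrite normrM; apply: le_trans IH; rewrite ler_piMl.
Qed.

(** The probability that coordinate [i] of the noisy copy of [x] is [+1]; the law of the copy is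
    thus again a product measure. *)
Definition noise (R : realType) (n : nat) (s : R) (alpha : 'I_n -> R)
    (x : cube n) (i : 'I_n) : R := s * (x i)%:R + (1 - s) * alpha i.

(* [noise_kernel s alpha x y] is the probability of moving from [x] to [y] when every
   coordinate is independently kept with probability [s] and otherwise resampled. *)
Definition noise_kernel (R : realType) (n : nat) (s : R) (alpha : 'I_n -> R)
    (x y : cube n) : R := mu_alpha (noise s alpha x) y.

Lemma noise_bounds (R : realType) (n : nat) (s : R) (alpha : 'I_n -> R)
    (x : cube n) (i : 'I_n) :
  0 <= s <= 1 -> 0 < alpha i < 1 -> 0 <= noise s alpha x i <= 1.
Proof.
by rewrite /noise => /andP[s0 s1] /andP[a0 a1]; case: (x i) => /=; nra.
Qed.

Lemma noise_kernel_reversible (R : realType) (n : nat) (s : R)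
    (alpha : 'I_n -> R) (x y : cube n) :
  mu_alpha alpha x * noise_kernel s alpha x y =
  mu_alpha alpha y * noise_kernel s alpha y x.
Proof.
rewrite /noise_kernel /mu_alpha -!big_split/=; apply: eq_bigr => i _.
by rewrite /noise; case: (x i); case: (y i) => /=; ring.
Qed.

Lemma noise_kernel0 (R : realType) (n : nat) (alpha : 'I_n -> R) (x y : cube n) :
  noise_kernel 0 alpha x y = mu_alpha alpha y.
Proof.
by apply: eq_bigr => i _; rewrite /noise mul0r add0r subr0 mul1r.
Qed.

Lemma noise_kernel1 (R : realType) (n : nat) (alpha : 'I_n -> R) (x y : cube n) :
  noise_kernel 1 alpha x y = (y == x)%:R.
Proof.
rewrite /noise_kernel /mu_alpha /noise.
have [->|/eqP yx] := eqVneq y x.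
  by rewrite big1// => i _; rewrite subrr mul0r addr0 mul1r; case: (x i); rewrite ?subr0.
have [i /negPf yxi] : exists i, y i != x i.
  apply/existsP; apply: contra_notT yx => /existsPn yx.
  by apply/ffunP => i; apply/eqP; have := yx i; rewrite negbK.
rewrite (bigD1 i)//= subrr mul0r addr0 mul1r.
by case: (x i) (y i) yxi => -[] //= _; rewrite ?subrr mul0r.
Qed.

(** * The derivative of the noise kernel and its reweighting *)

(** The [i]-th term of the product rule for the derivative of the kernel in [s]. *)
Definition noise_kernel_deriv (R : realType) (n : nat) (s : R)
    (alpha : 'I_n -> R) (i : 'I_n) (x y : cube n) : R :=
  \prod_j (if j == i then (if y j then (x j)%:R - alpha j else alpha j - (x j)%:R)
           else (if y j then noise s alpha x j else 1 - noise s alpha x j)).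

Lemma noise_kernel_expansion (R : realType) (n : nat) :
  exists2 C : R, 0 <= C & forall (alpha : 'I_n -> R) (s t : R) (x y : cube n),
    (forall i, 0 < alpha i < 1) -> 0 <= s <= 1 -> 0 <= t <= 1 ->
    `| noise_kernel t alpha x y - noise_kernel s alpha x y -
       (t - s) * \sum_i noise_kernel_deriv s alpha i x y | <= C * (t - s) ^+ 2.
Proof.
have [C C0 hC] := prod_expansion R n; exists C => // alpha s t x y al s01 t01.
pose m i := if y i then noise s alpha x i else 1 - noise s alpha x i.
pose e i := if y i then (x i)%:R - alpha i else alpha i - (x i)%:R.
have m1 i : `| m i | <= 1.
  have /andP[? ?] := noise_bounds x s01 (al i); rewrite ler_norml /m.
  by case: (y i); lra.
have e1 i : `| e i | <= 1.
  have /andP[? ?] := al i; rewrite ler_norml /e.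
  by case: (y i); case: (x i) => /=; lra.
have h1 : `| t - s | <= 1 by rewrite ler_norml; lra.
have := hC m e (t - s) m1 e1 h1.
rewrite (_ : \prod_i (m i + (t - s) * e i) = noise_kernel t alpha x y)//.
by apply: eq_bigr => i _; rewrite /m /e /noise; case: (y i); ring.
Qed.

(* Reweighting of the noise kernel: averaging [partial] against
   [noise_kernel * dweight] differentiates the semigroup, see
   [noise_kernel_derivE]. Such weights are not unique; supporting them on the less
   likely value of [y] keeps their moments bounded uniformly in [alpha]. *)
Definition dweight (R : realType) (s alpha : R) (x y : bool) : R :=
  let b := alpha <= 2^-1 in
  let r := (1 - s) * (if b then 1 - alpha else alpha) in
  if y == b then (if x == b then (1 - r)^-1 else - r^-1) else 0.

(** The one-coordinate case of the derivative formula: [1 - alpha] and [- alpha] are the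
    coefficients of the difference of [f] in [partial] at the two values of [y], and the right side
    is the derivative of [m] in [s]. *)
Lemma dweight_deriv (R : realType) (s alpha : R) (x : bool) :
  0 <= s < 1 -> 0 < alpha < 1 ->
  let m := s * x%:R + (1 - s) * alpha in
  m * dweight s alpha x true * (1 - alpha) -
  (1 - m) * dweight s alpha x false * alpha = x%:R - alpha.
Proof.
move=> /andP[s0 s1] /andP[a0 a1] /=; rewrite /dweight.
case: leP => _; [set r := (1 - s) * (1 - alpha)|set r := (1 - s) * alpha].
  have r0 : r != 0 by rewrite mulf_neq0// gt_eqF; lra.
  have r1 : 1 - r != 0 by rewrite gt_eqF// /r; nra.
  case: x; rewrite /= ?mulr0 mul0r subr0.
    by rewrite (_ : s * 1 + _ = 1 - r) ?mulfV ?mul1r// /r; ring.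
  have -> : (0 + (1 - s) * alpha) * - r^-1 * (1 - alpha) = - (r * r^-1) * alpha.
    by rewrite {2}/r; ring.
  by rewrite mulfV//; ring.
have r0 : r != 0 by rewrite mulf_neq0// gt_eqF; lra.
have r1 : 1 - r != 0 by rewrite gt_eqF// /r; nra.
case: x; rewrite /= ?mulr0 mul0r sub0r.
  have -> : (1 - (s * 1 + r)) * - r^-1 * alpha = - (r * r^-1) * (1 - alpha).
    by rewrite {1 3}/r; ring.
  by rewrite mulfV//; ring.
by rewrite add0r mulfV// mul1r sub0r.
Qed.

(** Here [y] is fixed and [x] is random: by reversibility [x] is true with probability [r].
    Symmetrization needs the weights centred under this law. *)
Lemma dweight_mean (R : realType) (s alpha : R) (y : bool) :
  0 <= s < 1 -> 0 < alpha < 1 ->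
  let r := s * y%:R + (1 - s) * alpha in
  r * dweight s alpha true y + (1 - r) * dweight s alpha false y = 0.
Proof.
move=> /andP[s0 s1] /andP[a0 a1] /=; rewrite /dweight.
case: leP => _; [set r := (1 - s) * (1 - alpha)|set r := (1 - s) * alpha].
  have r0 : r != 0 by rewrite mulf_neq0// gt_eqF; lra.
  have r1 : 1 - r != 0 by rewrite gt_eqF// /r; nra.
  case: y; rewrite /= ?mulr0 ?addr0//.
  rewrite (_ : s * 1 + _ = 1 - r); last by rewrite /r; ring.
  by rewrite mulfV// subKr mulrN mulfV// subrr.
have r0 : r != 0 by rewrite mulf_neq0// gt_eqF; lra.
have r1 : 1 - r != 0 by rewrite gt_eqF// /r; nra.
case: y; rewrite /= ?mulr0 ?addr0//.
by rewrite add0r mulrN !mulfV// addNr.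
Qed.

Lemma dweight_moment (R : realType) (p s alpha c : R) (y : bool) :
  1 <= p <= 2 -> 0 <= s < 1 -> 0 < alpha < 1 -> c ^+ 2 = s * (1 - s) ->
  let r := s * y%:R + (1 - s) * alpha in
  2 * (r * (1 - r)) *
    `| c * dweight s alpha true y - c * dweight s alpha false y | `^ p <= 2 `^ p.
Proof.
move=> /andP[p1 p2] /andP[s0 s1] /andP[a0 a1] cs /=; rewrite -mulrBr normrM /dweight.
have pn0 : p != 0 by rewrite gt_eqF//; lra.
have off (A : R) : A * (`|c| * `|0 - 0|) `^ p <= 2 `^ p.
  by rewrite subrr normr0 mulr0 powR0// mulr0 powR_ge0.
(* [q] is the mass of the likelier value under [alpha], and the two weights differ by
   [1 / (r (1 - r))]; [q >= 1/2] gives [s (1 - s) <= 2 r (1 - r)]. *)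
have on (q d : R) : 2^-1 <= q -> q < 1 -> let r := (1 - s) * q in
    `| d | = ((1 - r) * r)^-1 ->
    2 * ((1 - r) * r) * (`| c | * `| d |) `^ p <= 2 `^ p.
  move=> q2 q1 r ->; apply: two_point_moment.
  - by rewrite p2 andbT; lra.
  - by rewrite mulr_gt0// /r; nra.
  - have := sqr_ge0 (r - 2^-1); rewrite expr2; lra.
  - have q12 : 0 <= (1 - s) * (2 * q * (1 - q)) + s * (2 * q - 1).
      by rewrite addr_ge0 ?mulr_ge0//; lra.
    rewrite cs (_ : 2 * _ = s * (1 - s) +
      (1 - s) * ((1 - s) * (2 * q * (1 - q)) + s * (2 * q - 1))); last by rewrite /r; ring.
    by rewrite lerDl mulr_ge0//; lra.
have onV (r : R) : 0 < r -> 0 < 1 - r -> (1 - r)^-1 + r^-1 = ((1 - r) * r)^-1.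
  by move=> r0 r1; field; rewrite !gt_eqF.
case: (leP alpha 2^-1) => ha; case: y => //=.
  set q := 1 - alpha; set r := (1 - s) * q.
  rewrite (_ : s * 1 + _ = 1 - r); last by rewrite /r /q; ring.
  rewrite subKr; apply: on; rewrite /q; [lra|lra|].
  have r0 : 0 < r by rewrite mulr_gt0 /q//; lra.
  have r1 : 0 < 1 - r by rewrite /r /q; nra.
  by rewrite opprK onV// ger0_norm// invr_ge0 mulr_ge0 ?ltW.
set r := (1 - s) * alpha; rewrite mulr0 add0r [r * _]mulrC.
have r0 : 0 < r by rewrite mulr_gt0//; lra.
have r1 : 0 < 1 - r by rewrite /r; nra.
apply: on; [lra|lra|].
by rewrite -opprD normrN addrC onV// ger0_norm// invr_ge0 mulr_ge0 ?ltW.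
Qed.

(** * The speed of the noise semigroup *)

Lemma setcoordK (n : nat) (x : cube n) (i : 'I_n) (b c : bool) :
  setcoord (setcoord x i b) i c = setcoord x i c.
Proof. by apply/ffunP => j; rewrite !ffunE; case: eqP. Qed.

(** Pairing each point with its flip at [i] counts every edge in direction [i] twice; the factor 2
    cancels. *)
Lemma eq_sum_setcoord (R : realType) (X : lmodType R) (n : nat) (i : 'I_n)
    (A B : cube n -> X) :
  (forall y, A (setcoord y i true) + A (setcoord y i false) =
             B (setcoord y i true) + B (setcoord y i false)) ->
  \sum_y A y = \sum_y B y.
Proof.
move=> AB.
pose flip (y : cube n) := setcoord y i (~~ y i).
have flipK : involutive flip.
  move=> y; rewrite /flip setcoordK; apply/ffunP => j; rewrite !ffunE eqxx negbK.
  by case: eqP => // ->.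
have setcoord_id (y : cube n) : setcoord y i (y i) = y.
  by apply/ffunP => j; rewrite ffunE; case: eqP => // ->.
have double (F : cube n -> X) : (2 : R) *: \sum_y F y =
    \sum_y (F (setcoord y i true) + F (setcoord y i false)).
  rewrite scaler_nat mulr2n {2}(reindex_inj (inv_inj flipK)) -big_split/=.
  apply: eq_bigr => y _; rewrite -{1}[y]setcoord_id /flip.
  by case: (y i) => //=; rewrite addrC.
apply: (@scalerI _ _ (2 : R)); first by [].
by rewrite !double; apply: eq_bigr => y _.
Qed.

(** On an edge in direction [i], both sides are the common product [P] over the other coordinates
    times a multiple of [u - v]; the multiples agree by [dweight_deriv]. *)
Lemma noise_kernel_derivE (R : realType) (X : normedModType R) (n : nat) (s : R)
    (alpha : 'I_n -> R) (i : 'I_n) (f : cube n -> X) (x : cube n) :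
  0 <= s < 1 -> 0 < alpha i < 1 ->
  \sum_y noise_kernel_deriv s alpha i x y *: f y =
  \sum_y (noise_kernel s alpha x y * dweight s (alpha i) (x i) (y i)) *:
    partial (alpha i) i f y.
Proof.
move=> hs ha; apply: (eq_sum_setcoord (i := i)) => y.
pose m j := if y j then noise s alpha x j else 1 - noise s alpha x j.
set P := \prod_(j | j != i) m j.
have kernelE b : noise_kernel s alpha x (setcoord y i b) =
    (if b then noise s alpha x i else 1 - noise s alpha x i) * P.
  rewrite /noise_kernel /mu_alpha (bigD1 i)//= ffunE eqxx; congr (_ * _).
  by apply: eq_bigr => j /negPf ji; rewrite ffunE ji.
have derivE b : noise_kernel_deriv s alpha i x (setcoord y i b) =
    (if b then (x i)%:R - alpha i else alpha i - (x i)%:R) * P.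
  rewrite /noise_kernel_deriv (bigD1 i)//= ffunE !eqxx; congr (_ * _).
  by apply: eq_bigr => j /negPf ji; rewrite ffunE ji.
set u := f (setcoord y i true); set v := f (setcoord y i false).
have partialT : partial (alpha i) i f (setcoord y i true) = (1 - alpha i) *: (u - v).
  by rewrite /partial !setcoordK -/u -/v scalerBr !scalerBl !scale1r.
have partialF : partial (alpha i) i f (setcoord y i false) = (- alpha i) *: (u - v).
  rewrite /partial !setcoordK -/u -/v scalerBr !scaleNr !scalerBl scale1r.
  by rewrite opprB opprK -addrA addrC -addrA subrK.
rewrite !kernelE !derivE partialT partialF !ffunE eqxx !scalerA -scalerDl.
rewrite -[alpha i - _]opprB mulNr scaleNr -scalerBr; congr (_ *: _).
by rewrite -(dweight_deriv (x i) hs ha) /noise; ring.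
Qed.

Lemma noise_deriv_bound (R : realType) (X : normedModType R) (p T s c : R)
    (n : nat) (alpha : 'I_n -> R) (f : cube n -> X) :
  1 <= p <= 2 -> type_constants X p T -> (forall i, 0 < alpha i < 1) ->
  0 <= s < 1 -> c ^+ 2 = s * (1 - s) ->
  \sum_x mu_alpha alpha x *
    `| c *: \sum_y (\sum_i noise_kernel_deriv s alpha i x y) *: f y | `^ p <=
  2 `^ p * (T `^ p *
    \sum_i int_mu alpha (fun x => `| partial (alpha i) i f x | `^ p)).
Proof.
move=> hp hT al hs cs; have /andP[p1 p2] := hp; have /andP[s0 s1] := hs.
have s01 : 0 <= s <= 1 by rewrite s0 ltW.
have mu0 x : 0 <= mu_alpha alpha x.
  by apply: mu_alpha_ge0 => i; have /andP[? ?] := al i; rewrite !ltW.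
have noise01 y i : 0 <= noise s alpha y i <= 1 by exact: noise_bounds.
pose g (x y : cube n) : X := \sum_i (c * dweight s (alpha i) (x i) (y i)) *:
  partial (alpha i) i f y.
have derivE x : c *: \sum_y (\sum_i noise_kernel_deriv s alpha i x y) *: f y =
    \sum_y noise_kernel s alpha x y *: g x y.
  under eq_bigr do rewrite scaler_suml.
  rewrite exchange_big/= (eq_bigr _ (fun i _ => noise_kernel_derivE f x hs (al i))).
  rewrite exchange_big scaler_sumr/=; apply: eq_bigr => y _.
  rewrite !scaler_sumr; apply: eq_bigr => i _; rewrite !scalerA.
  by congr (_ *: _); rewrite mulrCA.
(* Jensen in [y], then reversibility: [y] becomes the starting point, so for fixed [y] the partial
   derivatives are fixed vectors. *)
apply: (@le_trans _ _ (\sum_x \sum_y mu_alpha alpha y *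
    (noise_kernel s alpha y x * `| g x y | `^ p))).
  apply: ler_sum => x _; rewrite derivE.
  apply: (le_trans (ler_wpM2l (mu0 x) (normr_jensen _ p1 _ (sum_mu_alpha _)))).
    by move=> y; apply: mu_alpha_ge0.
  rewrite mulr_sumr le_eqVlt; apply/orP; left; apply/eqP; apply: eq_bigr => y _.
  by rewrite !mulrA noise_kernel_reversible.
rewrite exchange_big/=.
apply: (@le_trans _ _ (\sum_y mu_alpha alpha y *
    (2 `^ p * (T `^ p * \sum_i `| partial (alpha i) i f y | `^ p)))).
  apply: ler_sum => y _; rewrite -mulr_sumr; apply: ler_wpM2l => //.
  apply: (type_mean_zero_sum (H := fun i b => c * dweight s (alpha i) b (y i)))
    => // i.
    have := dweight_mean (y i) hs (al i); rewrite -/(noise s alpha y i) /= => h0.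
    by rewrite -[RHS](mulr0 c) -h0; ring.
  exact: dweight_moment.
rewrite le_eqVlt; apply/orP; left; apply/eqP.
rewrite /int_mu exchange_big/= !mulr_sumr; apply: eq_bigr => y _.
by rewrite -mulr_sumr; ring.
Qed.

(** * The flow in the angle variable *)

Definition flow (R : realType) (X : normedModType R) (n : nat)
    (alpha : 'I_n -> R) (f : cube n -> X) (t : R) (x : cube n) : X :=
  \sum_y noise_kernel ((1 - cos t) / 2) alpha x y *: f y.

Lemma flow0 (R : realType) (X : normedModType R) (n : nat) (alpha : 'I_n -> R)
    (f : cube n -> X) (x : cube n) : flow alpha f 0 x = int_mu_vec alpha f.
Proof.
rewrite /flow cos0 subrr mul0r; apply: eq_bigr => y _.
by rewrite noise_kernel0.
Qed.

Lemma flow_pi (R : realType) (X : normedModType R) (n : nat) (alpha : 'I_n -> R)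
    (f : cube n -> X) (x : cube n) : flow alpha f pi x = f x.
Proof.
rewrite /flow cospi opprK (_ : (1 + 1) / 2 = 1); last by rewrite divff.
rewrite (bigD1 x)//= noise_kernel1 eqxx scale1r big1 ?addr0// => y /negPf yx.
by rewrite noise_kernel1 yx scale0r.
Qed.

(* In the angle [t], with [s = (1 - cos t) / 2], the singular weight
   [1 / sqrt (s * (1 - s))] of [noise_deriv_bound] disappears, so the flow has
   bounded speed up to an error that is quadratic in the step. *)
Lemma flow_step (R : realType) (X : normedModType R) (p T K : R)
    (n : nat) (alpha : 'I_n -> R) (f : cube n -> X) :
  1 <= p <= 2 -> type_constants X p T -> (forall i, 0 < alpha i < 1) -> 0 < K ->
  2 `^ p * (T `^ p *
    \sum_i int_mu alpha (fun x => `| partial (alpha i) i f x | `^ p)) <= K `^ p ->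
  exists2 C : R, 0 < C & forall a b : R, 0 <= a -> a < b -> b <= pi ->
    \sum_x mu_alpha alpha x * `| flow alpha f b x - flow alpha f a x | `^ p <=
    ((b - a) * K + C * (b - a) ^+ 2) `^ p.
Proof.
move=> hp hT al K0 hK; have /andP[p1 p2] := hp.
have mu0 x : 0 <= mu_alpha alpha x.
  by apply: mu_alpha_ge0 => i; have /andP[? ?] := al i; rewrite !ltW.
have [C0 C00 hC0] := noise_kernel_expansion R n.
pose F := \sum_y `| f y |.
have F0 : 0 <= F by exact: sumr_ge0.
(* The summand 1 keeps the constant positive even if [f] vanishes, as [minkowski_le] requires. *)
exists ((C0 + n%:R) * F + 1); first by rewrite ltr_wpDl// mulr_ge0// addr_ge0.
move=> a b a0 ab bpi.
have ba0 : 0 < b - a by rewrite subr_gt0.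
pose s (t : R) := (1 - cos t) / 2.
have s01 t : 0 <= s t <= 1.
  by have := cos_geN1 t; have := cos_le1 t; rewrite /s; lra.
have sa : 0 <= s a < 1.
  have /andP[-> _] /= := s01 a; rewrite /s ltr_pdivrMr// mul1r.
  suff : -1 < cos a by lra.
  by rewrite -cospi ltr_cos ?in_itv/= ?pi_ge0 ?lexx// ?a0 ?ltW ?(lt_le_trans ab).
(* The derivative of [s] at [a], which is also a square root of [s a * (1 - s a)]. *)
pose c := sin a / 2.
have cs : c ^+ 2 = s a * (1 - s a).
  by rewrite /c expr_div_n sin2cos2 /s; field.
pose D x y := \sum_i noise_kernel_deriv (s a) alpha i x y.
have D_le x y : `| D x y | <= n%:R.
  apply: le_trans (ler_norm_sum _ _ _) _.
  have -> : n%:R = \sum_(i < n) (1 : R) by rewrite sumr_const card_ord.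
  apply: ler_sum => i _; rewrite normr_prod.
  apply: prodr_ile1 => j _; rewrite normr_ge0/= ler_norml.
  have /andP[? ?] := al j; have /andP[? ?] := noise_bounds x (s01 a) (al j).
  by case: (j == i); case: (y j); case: (x j) => /=; lra.
pose e x y := noise_kernel (s b) alpha x y - noise_kernel (s a) alpha x y -
  (b - a) * (c * D x y).
have e_le x y : `| e x y | <= (C0 + n%:R) * (b - a) ^+ 2.
  (* The first part is the error of the kernel expansion in [s], the second that of linearizing [s]
     at [a]. *)
  have -> : e x y = (noise_kernel (s b) alpha x y - noise_kernel (s a) alpha x y -
      (s b - s a) * D x y) + (s b - s a - (b - a) * c) * D x y.
    by rewrite /e; ring.
  rewrite (mulrDl C0); apply: le_trans (ler_normD _ _) _; apply: lerD.
    apply: le_trans (hC0 alpha _ _ x y al (s01 a) (s01 b)) _.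
    apply: ler_wpM2l => //; rewrite -(real_normK (num_real (s b - s a))).
    apply: lerXn2r; rewrite ?nnegrE ?(ltW ba0)//.
    rewrite (_ : s b - s a = - (cos b - cos a) / 2); last by rewrite /s; ring.
    rewrite normrM normrN (ger0_norm (_ : 0 <= 2^-1))//.
    by have := cos_lipschitz (ltW ab); have := normr_ge0 (cos b - cos a); lra.
  rewrite normrM mulrC; apply: ler_pM => //.
  rewrite (_ : _ - _ = - (cos b - cos a + (b - a) * sin a) / 2); last first.
    by rewrite /s /c; field.
  rewrite normrM normrN (ger0_norm (_ : 0 <= 2^-1))//.
  have := cos_taylor1 (ltW ab).
  by have := normr_ge0 (cos b - cos a + (b - a) * sin a); lra.
have flowE x : flow alpha f b x - flow alpha f a x =
    (b - a) *: (c *: \sum_y D x y *: f y) + \sum_y e x y *: f y.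
  rewrite /flow -sumrB !scaler_sumr -big_split/=; apply: eq_bigr => y _.
  by rewrite !scalerA -scalerBl -scalerDl; congr (_ *: _); rewrite /e /s; ring.
under eq_bigr do rewrite flowE.
apply: minkowski_le => //.
- by rewrite mulr_gt0.
- by rewrite mulr_gt0 ?exprn_gt0// ltr_wpDl// mulr_ge0// addr_ge0.
- rewrite (powRM _ (ltW ba0) (ltW K0)).
  under eq_bigr do rewrite normrZ (gtr0_norm ba0) (powRM _ (ltW ba0) (normr_ge0 _)) mulrCA.
  rewrite -mulr_sumr; apply: ler_wpM2l; first exact: powR_ge0.
  exact: le_trans (noise_deriv_bound f hp hT al sa cs) hK.
- apply: norm_sum_bound_powR => //; [lra|exact: sum_mu_alpha|] => x.
  apply: le_trans (ler_norm_sum _ _ _) _.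
  apply: (@le_trans _ _ ((C0 + n%:R) * (b - a) ^+ 2 * F)).
    rewrite mulr_sumr; apply: ler_sum => y _.
    by rewrite normrZ; apply: ler_wpM2r.
  by rewrite mulrAC ler_wpM2r ?sqr_ge0// lerDl.
Qed.

(** * Summation over the steps and the best type constant *)

Lemma powR_invK (R : realType) (p a : R) : 0 < p -> 0 <= a -> (a `^ p^-1) `^ p = a.
Proof. by move=> p0 a0; rewrite -powRrM mulVf ?gt_eqF// powRr1. Qed.

Lemma powR_inv_le (R : realType) (p a b : R) :
  0 < p -> 0 <= a -> 0 <= b -> a <= b `^ p -> a `^ p^-1 <= b.
Proof.
move=> p0 a0 b0 ab; have -> : b = (b `^ p) `^ p^-1.
  by rewrite -powRrM mulfV ?gt_eqF// powRr1.
by apply: ge0_ler_powR; rewrite ?nnegrE ?powR_ge0 ?invr_ge0 ?(ltW p0).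
Qed.

(** Over [m.+1] equal steps of [[0, pi]] the linear terms add up to [pi * K] and the quadratic
    errors to [C * pi ^+ 2 / m.+1], which tends to 0 because [C] is independent of the steps. *)
Lemma poincare_le (R : realType) (X : normedModType R) (p T K : R)
    (n : nat) (alpha : 'I_n -> R) (f : cube n -> X) :
  1 <= p <= 2 -> type_constants X p T -> (forall i, 0 < alpha i < 1) -> 0 < K ->
  2 `^ p * (T `^ p *
    \sum_i int_mu alpha (fun x => `| partial (alpha i) i f x | `^ p)) <= K `^ p ->
  int_mu alpha (fun x => `| f x - int_mu_vec alpha f | `^ p) <= (pi * K) `^ p.
Proof.
move=> hp hT al K0 hK; have /andP[p1 p2] := hp.
have p0 : 0 < p by lra.
have mu0 x : 0 <= mu_alpha alpha x.
  by apply: mu_alpha_ge0 => i; have /andP[? ?] := al i; rewrite !ltW.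
have [C C0 step] := flow_step hp hT al K0 hK.
set L := int_mu _ _.
have L0 : 0 <= L by apply: sumr_ge0 => x _; rewrite mulr_ge0 ?powR_ge0.
have Lm m : L <= (pi * K + C * pi ^+ 2 / m.+1%:R) `^ p.
  have m0 : 0 < m.+1%:R :> R by rewrite ltr0Sn.
  pose d : R := pi / m.+1%:R.
  have d0 : 0 < d by rewrite divr_gt0 ?pi_gt0.
  pose u k x := flow alpha f (k.+1%:R * d) x - flow alpha f (k%:R * d) x.
  have sumu x : \sum_(k < m.+1) u k x = f x - int_mu_vec alpha f.
    rewrite -(big_mkord xpredT (u ^~ x)).
    rewrite (telescope_sumr (fun k => flow alpha f (k%:R * d) x))// mul0r flow0.
    by rewrite /d mulrC divfK ?gt_eqF// flow_pi.
  have uk k : (k <= m)%N ->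
      \sum_x mu_alpha alpha x * `| u k x | `^ p <= (d * K + C * d ^+ 2) `^ p.
    move=> km.
    have kd : k.+1%:R * d - k%:R * d = d by rewrite -mulrBl -natr1 addrAC subrr add0r mul1r.
    have := step (k%:R * d) (k.+1%:R * d); rewrite kd; apply.
    - by rewrite mulr_ge0// ltW.
    - by rewrite ltr_pM2r// ltr_nat.
    - by rewrite /d mulrCA -[leRHS]mulr1 ler_pM2l ?pi_gt0// ler_pdivrMr// mul1r ler_nat.
  have A0 : 0 < d * K + C * d ^+ 2.
    by apply: addr_gt0; apply: mulr_gt0 => //; exact: exprn_gt0.
  have := minkowski_sum_le p1 mu0 A0 uk.
  under eq_bigr do rewrite sumu.
  suff -> : m.+1%:R * (d * K + C * d ^+ 2) = pi * K + C * pi ^+ 2 / m.+1%:R by [].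
  by rewrite /d; field; rewrite gt_eqF.
rewrite -(powR_invK p0 L0); apply: ge0_ler_powR; rewrite ?nnegrE ?powR_ge0 ?(ltW p0)//.
  by rewrite mulr_ge0 ?pi_ge0 ?ltW.
apply/ler_addgt0Pr => eps eps0.
pose m := Num.truncn (C * pi ^+ 2 / eps).
have hm : C * pi ^+ 2 / eps < m.+1%:R by exact: truncnS_gt.
have B0 : 0 <= pi * K + C * pi ^+ 2 / m.+1%:R.
  apply: addr_ge0; first exact: mulr_ge0 (pi_ge0 _) (ltW K0).
  by apply: divr_ge0 => //; exact: mulr_ge0 (ltW C0) (sqr_ge0 _).
apply: (@le_trans _ _ (pi * K + C * pi ^+ 2 / m.+1%:R)).
  exact: powR_inv_le p0 L0 B0 (Lm m).
by rewrite lerD2l ler_pdivrMr ?ltr0Sn// [leRHS]mulrC -ler_pdivrMr// ltW.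
Qed.

Theorem theorem3p3 (R : realType) (X : normedModType R) (p : R)
  (hp : 1 <= p <= 2) (hX : has_rademacher_type X p)
  (n : nat) (alpha : 'I_n -> R) (halpha : forall i, 0 < alpha i < 1)
  (f : cube n -> X) :
  int_mu alpha (fun x => `| f x - int_mu_vec alpha f | `^ p)
  <= (2 * pi * type_const X p) `^ p *
     \sum_(i < n) int_mu alpha (fun x => `| partial (alpha i) i f x | `^ p).
Proof.
have /andP[p1 p2] := hp.
have p0 : 0 < p by lra.
have mu0 x : 0 <= mu_alpha alpha x.
  by apply: mu_alpha_ge0 => i; have /andP[? ?] := halpha i; rewrite !ltW.
set L := int_mu _ _; set S := \sum_(i < n) _.
have L0 : 0 <= L by apply: sumr_ge0 => x _; rewrite mulr_ge0 ?powR_ge0.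
have S0 : 0 <= S.
  by apply: sumr_ge0 => i _; apply: sumr_ge0 => x _; rewrite mulr_ge0 ?powR_ge0.
(* After taking [p]-th roots the bound is linear in [T], so the infimum over [T] can be taken. *)
set l := L `^ p^-1; set d := S `^ p^-1.
have d0 : 0 <= d by exact: powR_ge0.
have bound T : type_constants X p T -> l <= 2 * pi * T * d.
  move=> hT; have T0 : 0 <= T by case: hT.
  apply/ler_addgt0Pr => eps eps0.
  have e0 : 0 < eps / pi by rewrite divr_gt0 ?pi_gt0.
  (* The slack keeps [K] positive when [T * d = 0], and becomes [eps] after multiplication by
     [pi]. *)
  pose K := 2 * T * d + eps / pi.
  have K0 : 0 < K by rewrite ltr_wpDl// !mulr_ge0.
  have hK : 2 `^ p * (T `^ p * S) <= K `^ p.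
    rewrite -(powR_invK p0 S0) -/d -!powRM ?mulr_ge0// mulrA.
    by apply: ge0_ler_powR; rewrite ?nnegrE ?mulr_ge0 ?(ltW p0) ?(ltW K0)// lerDl ltW.
  have piK0 : 0 <= pi * K by rewrite mulr_ge0 ?pi_ge0 ?ltW.
  have mulK (q : R) : q != 0 -> 2 * q * T * d + eps = q * (2 * T * d + eps / q).
    by move=> q0; field.
  rewrite mulK ?(lt0r_neq0 (pi_gt0 R))// -/K.
  apply: powR_inv_le => //.
  exact: poincare_le hp hT halpha K0 hK.
have T0 : 0 <= type_const X p by apply: lb_le_inf => // T [].
have boundinf : l <= 2 * pi * type_const X p * d.
  (* If [d = 0], any admissible [T] gives [l <= 0]; otherwise one divides by [2 * pi * d] before
     taking the infimum. *)
  move: d0; rewrite le_eqVlt => /predU1P[dz|dpos].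
    by case: hX => T /bound; rewrite -dz !mulr0.
  rewrite mulrAC -ler_pdivrMl ?mulr_gt0 ?pi_gt0//.
  apply: lb_le_inf => // T /bound hT.
  by rewrite ler_pdivrMl ?mulr_gt0 ?pi_gt0// mulrAC.
rewrite -(powR_invK p0 L0) -(powR_invK p0 S0) -/l -/d -powRM ?mulr_ge0 ?pi_ge0//.
by apply: ge0_ler_powR; rewrite ?nnegrE ?mulr_ge0 ?pi_ge0 ?powR_ge0 ?(ltW p0).
Qed.
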